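(* Let $G$ be a Hausdorff FSIN topological group. Every left precompact subset of $G$ is right precompact. Consequently, left and right precompact subsets of $G$ coincide, i.e. a subset of $G$ is left precompact if and only if it is right precompact.
   Context: Let $G$ be a topological group with identity $e$ and neighbourhood filter $\mathcal N_G(e)$ of $e$. The left (respectively right) uniformity of $G$ is generated by the entourages $\{(x,y)\in G\times G: x^{-1}y\in V\}$ (respectively $\{(x,y)\in G\times G: xy^{-1}\in V\}$), where $V$ ranges over $\mathcal N_G(e)$. A function $f:G\to\mathbb R$ is left (right) uniformly continuous if it is uniformly continuous with respect to the left (right) uniformity. $G$ is FSIN (functionally balanced) if every bounded left uniformly continuous function $f:G\to\mathbb R$ is right uniformly continuous. A subset $P\subseteq G$ is left precompact if for every $V\in\mathcal N_G(e)$ there is a finite $F\subseteq G$ with $P\subseteq FV$; it is right precompact if for every $V\in\mathcal N_G(e)$ there is a finite $F\subseteq G$ with $P\subseteq VF$. *)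

(* Defs.v *)
From HB Require Import structures.
From mathcomp Require Import all_boot all_order all_algebra.
From mathcomp Require Import all_classical all_reals all_analysis.

Set Implicit Arguments.
Unset Strict Implicit.
Unset Printing Implicit Defensive.

Import Order.TTheory GRing.Theory Num.Theory.
Import numFieldNormedType.Exports.

Local Open Scope classical_set_scope.
Local Open Scope group_scope.

HB.mixin Record isTopologicalGroup G & Topological G & Group G := {
  mulg_continuous : continuous (fun xy : G * G => xy.1 * xy.2) ;
  invg_continuous : continuous (fun x : G => x^-1)
}.

#[short(type="topologicalGroupType")]
HB.structure Definition TopologicalGroup :=
  {G of Topological G & Group G & isTopologicalGroup G}.

Section GroupEntourages.
Variable G : topologicalGroupType.
Implicit Types (x y : G) (V : set G) (A : set (G * G)).

Definition left_entourage : set_system (G * G) :=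
  filter_from (nbhs (1 : G)) (fun V => [set xy | V (xy.1^-1 * xy.2)]).

Definition right_entourage : set_system (G * G) :=
  filter_from (nbhs (1 : G)) (fun V => [set xy | V (xy.1 * xy.2^-1)]).

Let mulg_near x y (W : set G) : nbhs (x * y) W ->
  exists2 UV : set G * set G, nbhs x UV.1 /\ nbhs y UV.2 &
    forall u v, UV.1 u -> UV.2 v -> W (u * v).
Proof.
move=> /(@mulg_continuous G (x, y)) [[U V] /= nUV sUV].
by exists (U, V) => // u v Uu Vv; exact: (sUV (u, v)).
Qed.

Let mulg1_near V : nbhs (1 : G) V ->
  exists2 W, nbhs (1 : G) W & forall u v, W u -> W v -> V (u * v).
Proof.
move=> nV; have : nbhs (1 * 1 : G) V by rewrite mulg1.
move=> /mulg_near[[A B] /= [nA nB] sAB].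
exists (A `&` B); first exact: filterI.
by move=> u v [Au _] [_ Bv]; exact: sAB.
Qed.

Let invg1_near V : nbhs (1 : G) V -> nbhs (1 : G) [set x | V x^-1].
Proof.
by move=> nV; have := @invg_continuous G 1; apply; rewrite invg1.
Qed.

Let mull_near z x (W : set G) : nbhs (z * x) W -> nbhs x [set y | W (z * y)].
Proof.
move=> /mulg_near[[A B] /= [nA nB] sAB].
by apply: filterS nB => y By; apply: sAB => //; exact: nbhs_singleton.
Qed.

Let mulr_near z x (W : set G) : nbhs (x * z) W -> nbhs x [set y | W (y * z)].
Proof.
move=> /mulg_near[[A B] /= [nA nB] sAB].
by apply: filterS nA => y Ay; apply: sAB => //; exact: nbhs_singleton.
Qed.

Lemma left_entourage_filter : Filter left_entourage.
Proof.
apply: filter_from_filter; first by exists setT; exact: filterT.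
by move=> U V nU nV; exists (U `&` V) => //; exact: filterI.
Qed.

Lemma right_entourage_filter : Filter right_entourage.
Proof.
apply: filter_from_filter; first by exists setT; exact: filterT.
by move=> U V nU nV; exists (U `&` V) => //; exact: filterI.
Qed.

Lemma left_entourage_diagonal A : left_entourage A -> diagonal `<=` A.
Proof.
move=> [V nV sVA] [x y]; rewrite /diagonal /= => xy; apply: sVA => /=; rewrite xy mulVg.
exact: nbhs_singleton.
Qed.

Lemma right_entourage_diagonal A : right_entourage A -> diagonal `<=` A.
Proof.
move=> [V nV sVA] [x y]; rewrite /diagonal /= => xy; apply: sVA => /=; rewrite xy mulgV.
exact: nbhs_singleton.
Qed.

Lemma left_entourage_inv A : left_entourage A -> left_entourage A^-1%relation.
Proof.
move=> [V nV sVA]; exists [set x | V x^-1]; first exact: invg1_near.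
by move=> [x y] /= Vxy; apply: sVA; rewrite /= -[X in V X]invgK invgM invgK.
Qed.

Lemma right_entourage_inv A : right_entourage A -> right_entourage A^-1%relation.
Proof.
move=> [V nV sVA]; exists [set x | V x^-1]; first exact: invg1_near.
by move=> [x y] /= Vxy; apply: sVA; rewrite /= -[X in V X]invgK invgM invgK.
Qed.

Lemma left_entourage_split A : left_entourage A ->
  exists2 B, left_entourage B & (B \; B `<=` A)%relation.
Proof.
move=> [V nV sVA]; have [W nW sWV] := mulg1_near nV.
exists [set xy | W (xy.1^-1 * xy.2)]; first by exists W.
move=> [x y] [z /= Wxz Wzy]; apply: sVA => /=.
by have := sWV _ _ Wxz Wzy; rewrite mulgA mulgK.
Qed.

Lemma right_entourage_split A : right_entourage A ->
  exists2 B, right_entourage B & (B \; B `<=` A)%relation.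
Proof.
move=> [V nV sVA]; have [W nW sWV] := mulg1_near nV.
exists [set xy | W (xy.1 * xy.2^-1)]; first by exists W.
move=> [x y] [z /= Wxz Wzy]; apply: sVA => /=.
by have := sWV _ _ Wxz Wzy; rewrite mulgA mulgVK.
Qed.

Lemma left_entourage_nbhsE : nbhs = nbhs_ left_entourage.
Proof.
apply/funext => x; apply/seteqP; split=> W.
  move=> nW; exists [set ab | W (x * (ab.1^-1 * ab.2))].
    by exists [set v | W (x * v)] => //; apply: mull_near; rewrite mulg1.
  by move=> y /xsectionP /=; rewrite mulVKg.
move=> [A [V nV sVA] sAW].
have nV' : nbhs (x^-1 * x) V by rewrite mulVg.
by apply: filterS (mull_near nV') => y Vy; apply/sAW/xsectionP/sVA.
Qed.

Lemma right_entourage_nbhsE : nbhs = nbhs_ right_entourage.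
Proof.
apply/funext => x; apply/seteqP; split=> W.
  move=> nW; exists [set ab | W ((ab.1 * ab.2^-1)^-1 * x)].
    exists [set v | W (v^-1 * x)] => //.
    by apply: (@invg1_near [set v | W (v * x)]); apply: mulr_near; rewrite mul1g.
  by move=> y /xsectionP /=; rewrite invgF mulgVK.
move=> [A [V nV sVA] sAW].
have nV' : nbhs (x * x^-1) [set v | V v^-1] by rewrite mulgV; exact: invg1_near.
apply: filterS (mulr_near nV') => y /= Vy; apply/sAW/xsectionP/sVA => /=.
by rewrite -invgF.
Qed.

End GroupEntourages.

(* Aliases of the carrier, so that one group can bear both uniformities. *)
Definition left_uniform (G : topologicalGroupType) : Type := G.
Definition right_uniform (G : topologicalGroupType) : Type := G.

HB.instance Definition _ (G : topologicalGroupType) :=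
  TopologicalGroup.on (left_uniform G).
HB.instance Definition _ (G : topologicalGroupType) :=
  Nbhs_isUniform_mixin.Build (left_uniform G)
    (left_entourage_filter G) (@left_entourage_diagonal G)
    (@left_entourage_inv G) (@left_entourage_split G) (left_entourage_nbhsE G).

HB.instance Definition _ (G : topologicalGroupType) :=
  TopologicalGroup.on (right_uniform G).
HB.instance Definition _ (G : topologicalGroupType) :=
  Nbhs_isUniform_mixin.Build (right_uniform G)
    (right_entourage_filter G) (@right_entourage_diagonal G)
    (@right_entourage_inv G) (@right_entourage_split G)
    (right_entourage_nbhsE G).

Section Definitions.
Variables (R : realType) (G : topologicalGroupType).

Definition left_unif_continuous (f : G -> R) :=
  unif_continuous (f : left_uniform G -> R).

Definition right_unif_continuous (f : G -> R) :=
  unif_continuous (f : right_uniform G -> R).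

Definition FSIN := forall f : G -> R,
  bounded_fun f -> left_unif_continuous f -> right_unif_continuous f.

Definition left_precompact (P : set G) := forall V : set G, nbhs (1 : G) V ->
  exists2 F : set G, finite_set F & P `<=` [set x * v | x in F & v in V].

Definition right_precompact (P : set G) := forall V : set G, nbhs (1 : G) V ->
  exists2 F : set G, finite_set F & P `<=` [set v * x | v in V & x in F].

End Definitions.

(* Main.v *)
Require Import Defs.
From mathcomp Require Import all_boot all_order all_algebra finmap.
From mathcomp Require Import all_classical all_reals all_analysis lra.

Set Implicit Arguments.
Unset Strict Implicit.
Unset Printing Implicit Defensive.

Import Order.TTheory GRing.Theory Num.Theory.
Import numFieldNormedType.Exports.

(** Why it is true.  Inversion exchanges left and right precompactness, so it is
    enough that a left precompact set [P] is right precompact.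

    The FSIN hypothesis is used in one form only ([FSIN_mul_near]): for every
    set [A] and every neighbourhood [V] of [1] there is a neighbourhood [W] of
    [1] with [A W <= V A].  Indeed, in the left uniformity a bounded uniformly
    continuous function separates [A^-1] from the complement of [A^-1 V^-1]; its
    right uniform continuity gives [W^-1 A^-1 <= A^-1 V^-1], and one inverts.

    Suppose that [P] is left precompact but not right precompact.  Then [P]
    contains a sequence [p] that is right uniformly discrete: for some
    neighbourhood [S] of [1], [p n] is outside [S (p m)] when [m <> n].  By left
    precompactness, an ultrafilter [F] on the indices that refines the cofinite
    filter is left Cauchy along [p]: for each [W] there is [U] in [F] such that
    [p n^-1 p m] lies in [W] for all [n], [m] in [U].  Applying the inclusion
    above to the whole sequence, for [m], [n] in a suitable member of [F] the
    product [p m p n^-1 p m] is right close to some term [p r].  When [m] is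
    fixed and [n] moves along [F], this product varies little, so by
    discreteness [r = r m] depends on [m] alone; and [r m <> m], since otherwise
    [p m p n^-1] would be small.

    A map without fixed points admits a member [B] of [F] such that [r m] is not
    in [B] for [m] in [B] ([ultra_disjoint_from_image]).  The inclusion
    [A W <= V A] for [A = {p b | b in B}] now says that, for [m] in [B] and [m],
    [n] far along [F], [p m p n^-1 p m] is right close to [p b] for some [b] in
    [B].  It is also right close to [p (r m)], so [b = r m] by discreteness, and
    [r m] is in [B]: a contradiction. *)

Local Open Scope classical_set_scope.
Local Open Scope ring_scope.

(** * Separation by bounded uniformly continuous functions *)

(** The gauge of [E] is a pseudometric uniformity, coarser than the given one,
    for which [E] is an entourage.  The distance to [A] for this pseudometric is
    the required function: it is 1-Lipschitz, and bounded because the gauge has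
    diameter at most 2. *)
Lemma unif_continuous_separation (R : realType) (T : uniformType) (A : set T)
    (E : set (T * T)) : A !=set0 -> entourage E ->
  exists f : T -> R, exists2 e : R, 0 < e &
    [/\ bounded_fun f, unif_continuous f, forall x, A x -> f x = 0 &
        forall y, (forall x, A x -> ~ E (x, y)) -> e <= f y].
Proof.
move=> [a Aa] entE; pose T' : pseudoMetricType R := gauge.type entE.
have bounded2 x y : (@edist R T' (x, y) <= 2%:E)%E.
  by apply: edist_fin => //; exact: countable_uniform.countable_uniform_bounded.
have dist2 x : (@edist_inf R T' A x <= 2%:E)%E.
  by apply: (le_trans _ (bounded2 x a)); apply: ereal_inf_lbound; exists a.
have dist_fin x : @edist_inf R T' A x \is a fin_num.
  rewrite ge0_fin_numE ?edist_inf_ge0//.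
  exact: (le_lt_trans (dist2 x) (ltry _)).
pose f (x : T') : R := fine (@edist_inf R T' A x).
have f_lip x y (r : R) : 0 < r -> @ball R T' x r y -> f x <= r + f y.
  move=> r0 xy; rewrite -lee_fin EFinD !fineK//.
  apply: (le_trans (edist_inf_triangle _ _ y)); apply: leeD => //.
  exact: (@edist_fin R T' _ (x, y)).
have [e /= e0 subE] : @entourage_ R T' T' (@ball R T') E.
  by rewrite entourage_ballE; exists 0%N => // z -[].
exists f, e => //; split.
- exists 2; split; first exact: num_real.
  move=> r r2 x _ /=; rewrite ger0_norm ?fine_ge0 ?edist_inf_ge0//.
  by apply: le_trans (ltW r2); rewrite -lee_fin fineK.
- move=> B; rewrite -entourage_ballE => -[r /= r0 subB].
  suff : @entourage T' [set xy | B (f xy.1, f xy.2)] by exact: gauge.gauge_ent.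
  rewrite -(@entourage_ballE R T'); exists (r / 2); first exact: divr_gt0.
  move=> [x y] /= xy.
  apply: subB; rewrite /ball/= ltr_norml.
  have r20 : 0 < r / 2 by exact: divr_gt0.
  have := f_lip _ _ _ r20 xy; have := f_lip _ _ _ r20 (ball_sym xy).
  by move=> *; apply/andP; split; lra.
- by move=> x Ax; rewrite /f edist_inf0.
- move=> y farA; rewrite leNgt; apply/negP.
  rewrite -lte_fin fineK// => /ereal_inf_lt[_ [x Ax <-]].
  move=> /(@edist_lt_ball R T' _ (y, x)) yx.
  by apply: (farA x Ax); apply: subE; exact: ball_sym.
Qed.

Local Close Scope ring_scope.

(** * Ultrafilters and maps without fixed points *)

(** Each step of [f] inside [D] lowers the rank, so the orbit of [x] leaves [D]
    after finitely many steps; the parity of their number is the colour of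
    [x]. *)
Lemma parity_colouring (T : Type) (f : T -> T) (D : pred T) (rank : T -> nat) :
  (forall x, D x -> rank (f x) < rank x) ->
  exists c : T -> bool, forall x, D x -> c (f x) != c x.
Proof.
move=> rank_f.
(* [k] is fuel; any [k] above the rank gives the same colour. *)
pose fix col k x {struct k} :=
  if k is k'.+1 then D x && ~~ col k' (f x) else false.
have col_eq k l x : rank x < k -> rank x < l -> col k x = col l x.
  elim: k l x => [//|k IHk] [//|l] x; rewrite !ltnS => xk xl /=.
  case Dx : (D x) => //=; congr (~~ _).
  by apply: IHk; [move: xk | move: xl]; apply: leq_trans; exact: rank_f.
exists (fun x => col (rank x).+1 x) => x Dx.
rewrite (col_eq (rank (f x)).+1 (rank x)) ?rank_f//= Dx /=.
by case: (col _ _).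
Qed.

Lemma ultra_finite_bigcup (T : Type) (I : choiceType) (F : set_system T)
    (D : set I) (A : I -> set T) : UltraFilter F -> finite_set D ->
  F (\bigcup_(i in D) A i) -> exists2 i, D i & F (A i).
Proof.
move=> ultraF finD FA; apply: contrapT => noA.
have /(filterI FA) : F (\bigcap_(i in D) ~` A i).
  have -> : D = [set` fset_set D] by rewrite fset_setK.
  apply: filter_bigI => i; rewrite in_fset_set// inE => Di.
  by have [FAi|//] := in_ultra_setVsetC (A i) ultraF; case: noA; exists i.
by move=> /filter_ex[x [[i Di Ax] /(_ i Di)]].
Qed.

(** It suffices to 2-colour the indices so that [m] and [r m] differ in colour
    for [F]-almost all [m].  If [r m < m] almost always, parity colouring does
    it.  If [m < r m] almost always, orbits need not end; but they do when they
    are stopped before exceeding a bound [N], which gives a colouring [c N], and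
    the limit of [c N] as [N] runs along [F] is the required colouring. *)
Lemma ultra_disjoint_from_image (F : set_system nat) (r : nat -> nat) :
  UltraFilter F -> \oo `<=` F -> (forall m, r m != m) ->
  exists2 B, F B & forall m, B m -> ~ B (r m).
Proof.
move=> ultraF ooF r_neq.
suff [c Fc] : exists c : nat -> bool, F [set m | c (r m) != c m].
  have [Fc1|Fc0] := in_ultra_setVsetC [set m | c m] ultraF.
    exists ([set m | c (r m) != c m] `&` [set m | c m]); first exact: filterI.
    by move=> m /= [+ cm] [_ crm]; rewrite cm crm.
  exists ([set m | c (r m) != c m] `&` ~` [set m | c m]); first exact: filterI.
  by move=> m /= [+ /negP/negbTE cm] [_ /negP/negbTE crm]; rewrite cm crm.
have [Fdown|Fup] := in_ultra_setVsetC [set m | r m < m] ultraF.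
  have [//|c cP] := @parity_colouring _ r (fun m => r m < m) id.
  by exists c; apply: filterS Fdown => m /cP.
have /choice[c cP] N : exists c : nat -> bool,
    forall m, m < r m <= N -> c (r m) != c m.
  apply: (@parity_colouring _ _ _ (fun m => N - m)) => m /andP[mr rN].
  by apply: ltn_sub2l => //; exact: leq_trans rN.
exists (fun m => `[< F [set N | c N m] >]); apply: filterS Fup => m /= /negP.
rewrite -leqNgt leq_eqVlt eq_sym (negbTE (r_neq m))/= => mr.
have Fr : F [set N | c N (r m) != c N m].
  apply: ooF; exists (r m) => // N /= rN; apply: cP; exact/andP.
case: asboolP => [Frm|nFrm]; case: asboolP => [Fm|nFm] //.
  have [N /= [cr [crm cm]]] := filter_ex (filterI Fr (filterI Frm Fm)).
  by rewrite crm cm in cr.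
have [//|Frm] := in_ultra_setVsetC [set N | c N (r m)] ultraF.
have [//|Fm] := in_ultra_setVsetC [set N | c N m] ultraF.
have [N /=] := filter_ex (filterI Fr (filterI Frm Fm)).
by move=> [cr [/negP/negbTE crm /negP/negbTE cm]]; rewrite crm cm in cr.
Qed.

(** * Topological groups *)

Local Open Scope group_scope.

Section TopologicalGroupTheory.
Variable G : topologicalGroupType.
Implicit Types (A P V W : set G) (g x y : G).

Lemma nbhs1_inv V : nbhs (1 : G) V -> nbhs (1 : G) [set x | V x^-1].
Proof. by move=> nV; have := @invg_continuous G 1; apply; rewrite invg1. Qed.

Lemma nbhs1_split V : nbhs (1 : G) V ->
  exists W, [/\ nbhs (1 : G) W, forall x, W x -> W x^-1 &
    forall x y, W x -> W y -> V (x * y)].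
Proof.
move=> nV; have : nbhs (1 * 1 : G) V by rewrite mulg1.
move=> /(@mulg_continuous G (1, 1)) [[A B] /= [nA nB] sAB].
have nAB : nbhs (1 : G) (A `&` B) by exact: filterI.
exists ((A `&` B) `&` [set x | (A `&` B) x^-1]); split.
- exact: filterI nAB (nbhs1_inv nAB).
- by move=> x /= [ABx ABVx]; split=> //=; rewrite invgK.
- by move=> x y [[Ax _] _] [[_ By] _]; exact: (sAB (x, y)).
Qed.

Lemma nbhs1_conj g V : nbhs (1 : G) V ->
  nbhs (1 : G) [set x | V (g * x * g^-1)].
Proof.
move=> nV.
have : nbhs (g * 1 : G) [set x | V (x * g^-1)].
  have : nbhs (g * 1 * g^-1) V by rewrite mulg1 mulgV.
  move=> /(@mulg_continuous G (g * 1, g^-1)) [[A B] /= [nA nB] sAB].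
  apply: filterS nA => x Ax; apply: (sAB (x, g^-1)); split => //=.
  exact: nbhs_singleton.
move=> /(@mulg_continuous G (g, 1)) [[A B] /= [nA nB] sAB].
apply: filterS nB => x Bx; apply: (sAB (g, x)); split => //=.
exact: nbhs_singleton.
Qed.

(** This is the inclusion [A W <= V A].  A bounded left uniformly continuous [f]
    separates [A^-1] from the points outside [A^-1 V^-1]; its right uniform
    continuity then forces [W^-1 A^-1 <= A^-1 V^-1]. *)
Lemma FSIN_mul_near (R : realType) A V : FSIN R G -> nbhs (1 : G) V ->
  exists2 W, nbhs (1 : G) W &
    forall a w, A a -> W w -> exists2 b, A b & V (a * w * b^-1).
Proof.
move=> fsinG nV.
have [->|/set0P[a0 Aa0]] := eqVneq A set0; first by exists V.
pose E := [set xy : left_uniform G * left_uniform G | V (xy.2^-1 * xy.1)].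
have entE : entourage E.
  exists [set x | V x^-1]; first exact: nbhs1_inv.
  by move=> [x y]; rewrite /E/= invgM invgK.
have [|f [e e0 [bf ucf f0 fe]]] :=
    @unif_continuous_separation R (left_uniform G) [set x | A x^-1] E _ entE.
  by exists a0^-1; rewrite /= invgK.
have := fsinG f bf ucf; rewrite /right_unif_continuous/unif_continuous.
move=> /(_ [set st | ball st.1 e st.2]%R) [|W nW subW].
  by rewrite -entourage_ballE; exists e.
exists W => // a w Aa Ww; apply: contrapT => noA.
have /fe : forall x, [set x | A x^-1] x -> ~ E (x, w^-1 * a^-1).
  move=> x /= Ax; rewrite /E/= => Vx; apply: noA; exists x^-1 => //.
  by move: Vx; rewrite invgM !invgK.
have /subW/= : [set xy : G * G | W (xy.1 * xy.2^-1)] (a^-1, w^-1 * a^-1).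
  by rewrite /= invgM !invgK mulKg.
rewrite f0/= ?invgK// /ball/= sub0r normrN => /(le_lt_trans (ler_norm _)).
by move=> + /le_lt_trans => /[swap]/[apply]; rewrite ltxx.
Qed.

(** For some [V], finitely many right translates [V y] never cover [P], so each
    term can be chosen outside the translates given by the earlier ones. *)
Lemma non_right_precompact_seq P : ~ right_precompact P ->
  exists V (p : nat -> G), [/\ nbhs (1 : G) V, forall n, P (p n) &
    forall m n, m < n -> ~ V (p n * (p m)^-1)].
Proof.
move=> /existsNP[V /not_implyP[nV noF]].
have /choice[g gP] (s : seq G) :
    exists x, P x /\ forall y, y \in s -> ~ V (x * y^-1).
  apply: contrapT => nox; apply: noF; exists [set` s]; first exact: finite_seq.
  move=> x Px; apply: contrapT => nVs; apply: nox; exists x.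
  split=> // y ys Vxy; apply: nVs.
  by exists (x * y^-1) => //; exists y => //; rewrite mulgVK.
pose s n := iter n (fun s => g s :: s) [::].
have s_mem m n : m < n -> g (s m) \in s n.
  elim: n => // n IHn; rewrite ltnS leq_eqVlt => /predU1P[->|/IHn gs].
    by rewrite /s/= mem_head.
  by rewrite /s/= in_cons -/(s n) gs orbT.
exists V, (g \o s); split=> //= [n|m n /s_mem]; first exact: (gP _).1.
exact: (gP _).2.
Qed.

(** An ultrafilter on a totally bounded set is Cauchy: it contains one of the
    finitely many small pieces that cover the set. *)
Lemma left_precompact_cauchy P (p : nat -> G) (F : set_system nat) :
  left_precompact P -> (forall n, P (p n)) -> UltraFilter F ->
  forall W, nbhs (1 : G) W ->
    exists2 U, F U & forall n m, U n -> U m -> W ((p n)^-1 * p m).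
Proof.
move=> lpP Pp ultraF W /nbhs1_split[V [nV symV VV]].
have [D finD subD] := lpP V nV.
have [|x Dx FU] := @ultra_finite_bigcup _ _ F D
    (fun x => [set n | V (x^-1 * p n)]) ultraF finD.
  apply: filterS filterT => n _; have [x Dx [v Vv xv]] := subD _ (Pp n).
  by exists x => //=; rewrite -xv mulKg.
exists [set n | V (x^-1 * p n)] => // n m /= Vn Vm.
by have := VV _ _ (symV _ Vn) Vm; rewrite invgM invgK mulgA mulgK.
Qed.

(** The contradiction from a right uniformly discrete, left precompact sequence
    [p]: the products [p m p n^-1 p m] are followed along a left Cauchy
    ultrafilter. *)
Lemma left_precompact_right (R : realType) P :
  FSIN R G -> left_precompact P -> right_precompact P.
Proof.
move=> fsinG lpP; apply: contrapT => /non_right_precompact_seq.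
move=> [V0 [p [nV0 Pp pV0]]].
pose S := V0 `&` [set x | V0 x^-1].
have nS : nbhs (1 : G) S by exact: filterI nV0 (nbhs1_inv nV0).
have sep m n : S (p n * (p m)^-1) -> m = n.
  move=> [Vnm Vmn]; have [mn|nm|//] := ltngtP m n; first by case: (pV0 _ _ mn).
  by case: (pV0 _ _ nm); rewrite -invgF.
have [V1 [nV1 symV1 V1V1]] := nbhs1_split nS.
have V1S x : V1 x -> S x.
  by move=> V1x; rewrite -[x]mulg1; apply: V1V1 => //; exact: nbhs_singleton.
have [V2 [nV2 _ V2V2]] := nbhs1_split nV1.
have [F [ultraF ooF]] := ultraFilterLemma (_ : ProperFilter \oo).
have cauchyF := left_precompact_cauchy lpP Pp ultraF.
(* [n] is in [tr m r] when the product attached to [m] and [n] is near [p r]. *)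
pose tr m r := [set n | V1 (p m * (p n)^-1 * p m * (p r)^-1)].
have /choice[r rP] m :
    exists r, r != m /\ ((exists s, F (tr m s)) -> F (tr m r)).
  have [[s Fs]|nos] := pselect (exists s, F (tr m s)); last first.
    by exists m.+1; split=> //; rewrite gtn_eqF.
  (* If [s = m], then [p m p n^-1] is small for some [n > m]. *)
  exists s; split=> //; apply/eqP => sm; rewrite {}sm in Fs.
  have Fm : F [set n | m < n] by apply: ooF; exists m.+1.
  have [n [/= trn mn]] := filter_ex (filterI Fs Fm).
  by move: trn mn; rewrite /tr/= mulgK => /V1S/sep ->; rewrite ltnn.
have [B FB rB] := ultra_disjoint_from_image ultraF ooF (fun m => (rP m).1).
have [W0 nW0 W0P] := FSIN_mul_near (range p) fsinG nV2.
have [W1 nW1 W1P] := FSIN_mul_near (p @` B) fsinG nV1.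
have [U0 FU0 U0P] := cauchyF _ nW0.
have [U1 FU1 U1P] := cauchyF _ nW1.
have [m [[U0m U1m] Bm]] := filter_ex (filterI (filterI FU0 FU1) FB).
have Ftr : F (tr m (r m)).
  apply: (rP m).2.
  (* [Um] makes the products for [n] and [n0] differ by a left factor in [V2],
     so the index [s] found for [n0] serves all [n] in [Um]. *)
  have [Um FUm UmP] := cauchyF _ (nbhs1_conj (p m) nV2).
  have [n0 [U0n0 Umn0]] := filter_ex (filterI FU0 FUm).
  have [_ [s _ <-] V2s] := W0P _ _ (imageT p m) (U0P _ _ U0n0 U0m).
  exists s; apply: filterS FUm => n Umn; rewrite /tr/=.
  have := V2V2 _ _ (UmP _ _ Umn Umn0) V2s.
  by rewrite !mulgA !mulgVK mulgK.
have [n [U1n trn]] := filter_ex (filterI FU1 Ftr).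
have [_ [b Bb <-] V1b] := W1P _ _ (imageP p Bm) (U1P _ _ U1n U1m).
suff rb : r m = b by apply: (rB m Bm); rewrite rb.
rewrite [p m * _]mulgA in V1b; apply: sep.
by have := V1V1 _ _ (symV1 _ V1b) trn; rewrite invgM invgK mulgA mulgVK.
Qed.

Lemma right_precompact_inv P :
  right_precompact P -> left_precompact [set x | P x^-1].
Proof.
move=> rpP V /nbhs1_inv/rpP[D finD subD].
exists ((fun x : G => x^-1) @` D); first exact: finite_image.
move=> x /= /subD[v Vv [y Dy vy]]; exists y^-1; first exact: imageP.
by exists v^-1 => //; rewrite -invgM vy invgK.
Qed.

End TopologicalGroupTheory.

Theorem theorem2p1 (R : realType) (G : topologicalGroupType)
    (hausdorffG : hausdorff_space G) (fsinG : FSIN R G) :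
  (forall P : set G, left_precompact P -> right_precompact P) /\
  (forall P : set G, left_precompact P <-> right_precompact P).
Proof.
have left_right (P : set G) : left_precompact P -> right_precompact P.
  exact: (left_precompact_right fsinG).
split=> // P; split=> [/left_right//|rpP].
have := right_precompact_inv (left_right _ (right_precompact_inv rpP)).
by congr left_precompact; apply/seteqP; split=> x /=; rewrite invgK.
Qed.
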